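(* Let $k\ge 2$ be an even integer and $n\ge 1$ an odd integer. Then $a_k(n)$ satisfies the square power recurrence relation $$a_k(n)=\sum _{m=1}^{\left\lfloor \sqrt{n}\right\rfloor } (-1)^{m-1}a_k(n-m^2)+\sum _{m=1}^{\left\lfloor \sqrt{n/2}\right\rfloor } (-1)^{m-1}a_k(n-2m^2).$$ Thus $a_k(n)=a_k(n-1)+a_k(n-2)-a_k(n-4)-a_k(n-8)+a_k(n-9)+a_k(n-18)-a_k(n-16)-a_k(n-32)+\cdots$, where terms with negative argument are omitted.
   Context: For integers $n\ge 0$ and $k\ge 2$, $a_k(n)$ is the total number of parts divisible by $k$, counted with multiplicity, in all partitions of $n$ in which every part has multiplicity strictly less than $k$. (Writing a partition as $(\lambda_1^{m_1},\ldots,\lambda_\ell^{m_\ell})$ with distinct positive integer parts $\lambda_i$ of multiplicity $m_i\ge1$ and $\sum_i m_i\lambda_i=n$, $a_k(n)$ is the sum over all partitions of $n$ with all $m_i<k$ of $\sum_{i:\,k\mid\lambda_i} m_i$.) Empty sums are $0$. *)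

(* Defs.v *)
From mathcomp Require Import all_boot all_order all_algebra.

Set Implicit Arguments.
Unset Strict Implicit.
Unset Printing Implicit Defensive.

(* A partition of n is encoded by its multiplicities: mu i is the multiplicity
   (possibly 0) of the part i.+1.  Parts of a partition of n are at most n, and
   so are multiplicities, hence the finite domain and codomain lose nothing. *)
Definition is_partition (n : nat) (mu : {ffun 'I_n -> 'I_n.+1}) : bool :=
  \sum_(i < n) mu i * i.+1 == n.

Definition mult_lt (k n : nat) (mu : {ffun 'I_n -> 'I_n.+1}) : bool :=
  [forall i : 'I_n, mu i < k].

Definition a_ (k n : nat) : nat :=
  \sum_(mu : {ffun 'I_n -> 'I_n.+1} | is_partition mu && mult_lt k mu)
    \sum_(i < n | k %| i.+1) mu i.

(* Main.v *)
Require Import Defs.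
From mathcomp Require Import all_boot all_order all_algebra.
From mathcomp Require Import zify ring.

Import GRing.Theory Num.Theory.
Local Open Scope ring_scope.

(** Let A(q) be the generating function of a_k and
    theta(q) = 1 + 2 sum_(m >= 1) (-1)^m q^(m^2).  The recurrence at n says that
    the coefficient of q^n in A(q) (theta(q) + theta(q^2)) vanishes.  As n ranges
    over the odd integers, this means that the series is even.

    A part i contributes the factor 1 + q^i + ... + q^((k-1)i) to the generating
    function of the partitions, and when k divides i the marked version of this
    factor, sum_m m q^(m i), may replace it.  Since k is even, marked parts are
    even, and all factors of even parts are even functions of q.  For an odd i
    the factor is (1 - q^(k i)) / (1 - q^i), with an even numerator.  With
    O(q) = prod_(i odd) (1 - q^i), the product A(q) O(q) is therefore even
    ([is_even_part_poly]).

    With V(q) = prod_(i even) (1 - q^i), Gauss's identity reads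
    theta(q) = V(q) O(q)^2 ([theta_eqmodX]); substituting q^2 for q gives
    theta(q^2) = V(q) O(q) O(-q) ([theta_sqr_eqmodX]).  Hence
    A(q) (theta(q) + theta(q^2)) = (A(q) O(q)) V(q) (O(q) + O(-q)),
    a product of three even functions.

    Gauss's identity itself comes from a finite identity that is valid in every
    commutative ring and is proved by telescoping ([theta_finite]); no limit is
    needed.  All series are replaced by polynomials, truncated at a fixed N, and
    compared modulo X^(N+1). *)

(** * Congruence of polynomials modulo a power of X *)

Definition eqmodX {R : nzRingType} (N : nat) (p q : {poly R}) : Prop :=
  forall i, (i <= N)%N -> p`_i = q`_i.

Lemma eqmodX_mul (R : nzRingType) N (p p' q q' : {poly R}) :
  eqmodX N p q -> eqmodX N p' q' -> eqmodX N (p * p') (q * q').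
Proof.
move=> pq pq' i iN; rewrite !coefM; apply: eq_bigr => j _.
rewrite pq ?pq' //; first exact: leq_trans (leq_subr _ _) iN.
by rewrite (leq_trans _ iN) // -ltnS.
Qed.

(** A polynomial with constant coefficient 1 is invertible modulo X^(N+1); the
    coefficients of p and q are compared by strong induction on the degree. *)
Lemma eqmodX_cancel (R : nzRingType) N (r p q : {poly R}) :
  r`_0 = 1 -> eqmodX N (r * p) (r * q) -> eqmodX N p q.
Proof.
move=> r0 rpq i; have [m] := ubnP i; elim: m i => // m IHm i im iN.
have := rpq i iN; rewrite !coefM !big_ord_recl r0 !mul1r subn0.
under eq_bigr => j _.
  have ji := ltn_ord j.
  rewrite IHm; first over; rewrite lift0; lia.
by move/addIr.
Qed.

Lemma eqmodX_mulXn (R : nzRingType) N m (p : {poly R}) :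
  (N < m)%N -> eqmodX N (p * 'X^m) 0.
Proof. by move=> Nm i iN; rewrite coefMXn coef0 (leq_ltn_trans iN Nm). Qed.

Lemma eqmodX_comp_poly_Xn (R : nzRingType) N m (p q : {poly R}) :
  (0 < m)%N -> eqmodX N p q -> eqmodX N (p \Po 'X^m) (q \Po 'X^m).
Proof.
move=> m0 pq i iN; rewrite !coef_comp_poly_Xn //; case: ifP => // _.
by apply: pq; apply: leq_trans iN; apply: leq_div.
Qed.

(** * Even polynomials *)

(** Invariance under the ring morphism X |-> -X, rather than vanishing of the odd
    coefficients, makes closure under sums and products immediate. *)
Definition is_even_poly {R : nzRingType} (p : {poly R}) : Prop :=
  p \Po (- 'X) = p.

Lemma coef_comp_poly_oppX (R : comNzRingType) (p : {poly R}) i :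
  (p \Po (- 'X))`_i = (-1) ^+ i * p`_i.
Proof.
rewrite coef_comp_poly.
under eq_bigr => j _ do rewrite -mulN1r exprMn -polyCN -polyC_exp coefCM coefXn.
have [ip|ip] := ltnP i (size p).
  rewrite (bigD1 (Ordinal ip)) //= eqxx big1 => [|j ji].
    by rewrite mulr1 addr0 mulrC.
  have /negPf -> : i != j :> nat by rewrite eq_sym; exact: ji.
  by rewrite !mulr0.
rewrite (nth_default _ ip) mulr0 big1 // => j _.
by rewrite gtn_eqF ?mulr0 // (leq_trans (ltn_ord j) ip).
Qed.

Lemma is_even_poly_coef_odd (p : {poly int}) i :
  is_even_poly p -> odd i -> p`_i = 0.
Proof.
move=> ev oi; have := coef_comp_poly_oppX _ p i.
rewrite ev -signr_odd oi expr1 mulN1r => /eqP.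
by rewrite -addr_eq0 -mulr2n mulrn_eq0 => /eqP.
Qed.

Lemma is_even_polyM (R : comNzRingType) (p q : {poly R}) :
  is_even_poly p -> is_even_poly q -> is_even_poly (p * q).
Proof. by rewrite /is_even_poly rmorphM /= => -> ->. Qed.

Lemma is_even_poly_sum (R : comNzRingType) (I : Type) (r : seq I) (P : pred I)
    (F : I -> {poly R}) :
  (forall i, P i -> is_even_poly (F i)) ->
  is_even_poly (\sum_(i <- r | P i) F i).
Proof. by move=> evF; rewrite /is_even_poly rmorph_sum; exact: eq_bigr. Qed.

Lemma is_even_poly_prod (R : comNzRingType) (I : Type) (r : seq I) (P : pred I)
    (F : I -> {poly R}) :
  (forall i, P i -> is_even_poly (F i)) ->
  is_even_poly (\prod_(i <- r | P i) F i).
Proof. by move=> evF; rewrite /is_even_poly rmorph_prod; exact: eq_bigr. Qed.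

Lemma is_even_polyXn (R : comNzRingType) m :
  ~~ odd m -> is_even_poly ('X^m : {poly R}).
Proof.
move=> om; rewrite /is_even_poly rmorphXn /= comp_polyX -mulN1r exprMn.
by rewrite -signr_odd (negPf om) mul1r.
Qed.

(** * A finite form of Gauss's square power identity *)

(** With each square m^2 counted for both m and -m, this is the alternating
    theta sum over |m| <= n; the index t stands for m - 1. *)
Definition theta {R : comNzRingType} (q : R) (n : nat) : R :=
  1 + 2%:R * \sum_(t < n) (-1) ^+ t.+1 * q ^+ (t.+1 ^ 2).

(** Gauss's identity theta(q) prod (1 + q^i) = prod (1 - q^i) with an explicit
    error term, every summand of which is divisible by q^(n+1).  In the
    induction step, the error term for n+1 differs from (1 + q^(n+1)) times the
    one for n by a telescoping sum of the quantities u t below.  What remains at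
    the two ends is the change of the main term and the new square
    q^((n+1)^2). *)
Lemma theta_finite (R : comNzRingType) (q : R) n :
  let A s m := \prod_(s <= i < m) (1 - q ^+ i.+1) in
  let B t := \prod_(i < t) (1 + q ^+ i.+1) in
  theta q n * B n =
    A 0%N n +
    2%:R * \sum_(t < n) (-1) ^+ t.+1 * q ^+ (t.+1 * n.+1) * A t.+1 n * B t.
Proof.
move=> A B; elim: n => [|n IHn].
  by rewrite /theta /A /B !big_ord0 big_nil; ring.
pose u t := (-1) ^+ t * q ^+ (t.+1 * n.+1) * A t n * B t.
have AS s : (s <= n)%N -> A s n.+1 = A s n * (1 - q ^+ n.+1).
  by move=> sn; rewrite /A big_nat_recr.
have AP s : (s < n)%N -> A s n = (1 - q ^+ s.+1) * A s.+1 n.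
  by move=> sn; rewrite /A big_ltn.
have BS t : B t.+1 = B t * (1 + q ^+ t.+1) by rewrite /B big_ord_recr.
have step (t : 'I_n) :
    (-1) ^+ t.+1 * q ^+ (t.+1 * n.+2) * A t.+1 n.+1 * B t =
    (1 + q ^+ n.+1) * ((-1) ^+ t.+1 * q ^+ (t.+1 * n.+1) * A t.+1 n * B t)
    - (u t.+1 - u t).
  have tn := ltn_ord t; rewrite /u AS // (AP t) // BS.
  have -> : (t.+1 * n.+2 = t.+1 * n.+1 + t.+1)%N by lia.
  have -> : (t.+2 * n.+1 = t.+1 * n.+1 + n.+1)%N by lia.
  rewrite !exprD !exprS; ring.
have -> : theta q n.+1 = theta q n + 2%:R * ((-1) ^+ n.+1 * q ^+ (n.+1 ^ 2)).
  by rewrite /theta big_ord_recr /=; ring.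
rewrite mulrDl [in theta q n * _]BS mulrA IHn big_ord_recr /=.
under [X in _ = _ + _ * (X + _)]eq_bigr => t _ do rewrite step.
rewrite sumrB -mulr_sumr.
have -> : \sum_(i < n) (u i.+1 - u i) = u n - u 0%N.
  by rewrite -(big_mkord xpredT (fun i => u i.+1 - u i)) telescope_sumr.
rewrite /u AS // BS.
have An m : A m m = 1 by rewrite /A big_geq.
rewrite !An mul1n.
have -> : (n.+1 ^ 2 = n.+1 * n.+1)%N by rewrite mulnn.
have -> : (n.+1 * n.+2 = n.+1 * n.+1 + n.+1)%N by lia.
have -> : B 0%N = 1 by rewrite /B big_ord0.
rewrite !exprD (exprS (-1) n) expr0.
ring.
Qed.

(** * Gauss's identity as a product over odd and even parts *)

Definition odd_prod {R : comNzRingType} (q : R) (N : nat) : R :=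
  \prod_(0 <= i < N | odd i.+1) (1 - q ^+ i.+1).

Definition even_prod {R : comNzRingType} (q : R) (N : nat) : R :=
  \prod_(0 <= i < N | ~~ odd i.+1) (1 - q ^+ i.+1).

Lemma odd_prod_even_prod (R : comNzRingType) (q : R) N :
  odd_prod q N * even_prod q N = \prod_(0 <= i < N) (1 - q ^+ i.+1).
Proof. by rewrite [RHS](bigID (fun i => odd i.+1)). Qed.

Lemma prod_sqr_even_prod (R : comNzRingType) (q : R) N :
  \prod_(0 <= i < N) (1 - (q ^+ 2) ^+ i.+1) = even_prod q N.*2.
Proof.
elim: N => [|N IHN]; first by rewrite /even_prod !big_nil.
rewrite big_nat_recr //= IHN /even_prod doubleS.
rewrite [RHS]big_mkcond !big_nat_recr //= -big_mkcond /= odd_double /= mulr1.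
by rewrite -exprM; congr (_ * (1 - q ^+ _)); lia.
Qed.

Lemma even_prod_eqmodX (R : comNzRingType) N M :
  (N <= M)%N -> eqmodX N (even_prod ('X : {poly R}) M) (even_prod 'X N).
Proof.
elim: M => [|M IHM]; first by rewrite leqn0 => /eqP->.
rewrite leq_eqVlt => /predU1P[-> //|NM] i iN.
rewrite /even_prod big_mkcond big_nat_recr //= -big_mkcond /=.
case: ifP => _; last by rewrite mulr1 IHM.
rewrite mulrBr mulr1 coefB (eqmodX_mulXn _ _ _ _ NM) // coef0 subr0.
exact: IHM.
Qed.

(** Multiply by B = prod (1 + q^i).  On the left the finite identity gives
    prod (1 - q^i) = O V.  On the right
    B O V = prod (1 - q^(2i)) = V modulo X^(N+1), so that B V O^2 = V O as well.
    The constant coefficient of B is 1, hence B cancels. *)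
Lemma theta_eqmodX (R : comNzRingType) N :
  eqmodX N (theta ('X : {poly R}) N) (even_prod 'X N * odd_prod 'X N ^+ 2).
Proof.
set B : {poly R} := \prod_(i < N) (1 + 'X ^+ i.+1).
have B0 : B`_0 = 1.
  rewrite -horner_coef0 /B horner_prod big1 // => i _.
  by rewrite !hornerE expr0n /= addr0.
have BOE : B * odd_prod 'X N * even_prod 'X N = even_prod 'X N.*2.
  rewrite -mulrA odd_prod_even_prod -prod_sqr_even_prod !big_mkord -big_split.
  by apply: eq_bigr => i _ /=; rewrite -exprM mulnC exprM; ring.
apply: (eqmodX_cancel _ _ _ _ _ B0) => i iN.
rewrite mulrC theta_finite coefD [X in _ + X](_ : _ = 0) ?addr0.
  have -> : B * (even_prod 'X N * odd_prod 'X N ^+ 2) =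
      (B * odd_prod 'X N * even_prod 'X N) * odd_prod 'X N by ring.
  rewrite BOE -odd_prod_even_prod mulrC.
  apply: (eqmodX_mul _ N) iN => //.
  by move=> j jN; rewrite (even_prod_eqmodX _ _ _ _ j jN) // -addnn leq_addr.
rewrite mulr_sumr coef_sum big1 // => t _.
set a := (-1) ^+ _; set b := 'X ^+ _; set c := \prod_(_ <= _ < _) _.
set d := \prod_(_ < _) _.
have -> : 2%:R * (a * b * c * d) = (2%:R * a * c * d) * b.
  by ring.
have lt : (N < t.+1 * N.+1)%N by nia.
by rewrite (eqmodX_mulXn _ _ _ _ lt) // coef0.
Qed.

Lemma rmorph_theta (R S : comNzRingType) (f : {rmorphism R -> S}) q N :
  f (theta q N) = theta (f q) N.
Proof.
rewrite /theta rmorphD rmorph1 rmorphM rmorph_nat rmorph_sum.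
congr (1 + 2%:R * _); apply: eq_bigr => t _.
by rewrite rmorphM rmorph_sign rmorphXn.
Qed.

(** This is O(-q), since (-q)^i = - q^i for odd i. *)
Definition odd_prodN {R : comNzRingType} (q : R) (N : nat) : R :=
  \prod_(0 <= i < N | odd i.+1) (1 + q ^+ i.+1).

(** Substituting X^2 in V O^2 = (O V) O turns O V = prod (1 - q^i) into
    prod (1 - q^(2i)) = V, and 1 - q^(2i) = (1 - q^i) (1 + q^i) turns the last
    factor O into O(q) O(-q). *)
Lemma theta_sqr_eqmodX (R : comNzRingType) N :
  eqmodX N (theta ('X^2 : {poly R}) N)
    (even_prod 'X N * odd_prod 'X N * odd_prodN 'X N).
Proof.
have compX (P : pred nat) :
    (\prod_(0 <= i < N | P i) (1 - 'X ^+ i.+1) : {poly R}) \Po 'X^2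
    = \prod_(0 <= i < N | P i) (1 - ('X^2) ^+ i.+1).
  rewrite rmorph_prod; apply: eq_bigr => i _.
  by rewrite rmorphB rmorph1 rmorphXn /= comp_polyX.
have -> : theta ('X^2 : {poly R}) N = theta 'X N \Po 'X^2.
  by rewrite (rmorph_theta _ _ (comp_poly 'X^2)) /= comp_polyX.
move=> i iN; rewrite (eqmodX_comp_poly_Xn _ _ _ _ _ _ (theta_eqmodX R N)) //.
have -> : even_prod 'X N * odd_prod 'X N ^+ 2 =
   (odd_prod 'X N * even_prod 'X N) * odd_prod 'X N :> {poly R} by ring.
rewrite rmorphM /= odd_prod_even_prod compX prod_sqr_even_prod compX -mulrA.
apply: (eqmodX_mul _ N) iN => //.
  by apply: even_prod_eqmodX; rewrite -addnn leq_addr.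
rewrite /odd_prod /odd_prodN -big_split => j _; congr ((_ : {poly R})`_j).
by apply: eq_bigr => l _ /=; rewrite -exprM mulnC exprM; ring.
Qed.

Lemma odd_prod_comp_oppX (R : comNzRingType) N :
  odd_prod ('X : {poly R}) N \Po (- 'X) = odd_prodN 'X N.
Proof.
rewrite rmorph_prod; apply: eq_bigr => i oi.
rewrite rmorphB rmorph1 rmorphXn /= comp_polyX exprNn -signr_odd oi.
by rewrite expr1 mulN1r opprK.
Qed.

Lemma is_even_poly_odd_prodD (R : comNzRingType) N :
  is_even_poly (odd_prod ('X : {poly R}) N + odd_prodN 'X N).
Proof.
rewrite /is_even_poly rmorphD /= -odd_prod_comp_oppX -comp_polyA.
have -> : (- 'X : {poly R}) \Po (- 'X) = 'X
  by rewrite rmorphN /= comp_polyX opprK.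
by rewrite comp_polyXr addrC.
Qed.

Lemma is_even_poly_even_prod (R : comNzRingType) N :
  is_even_poly (even_prod ('X : {poly R}) N).
Proof.
apply: is_even_poly_prod => i ei.
by rewrite /is_even_poly rmorphB rmorph1 /= (is_even_polyXn _ _ ei).
Qed.

(** * Partitions with a common bound on the parts *)

(** The multiplicity function extended by 0 to all of nat, so that encodings
    over different finite index types can be compared. *)
Definition mult_of {n M : nat} (mu : {ffun 'I_n -> 'I_M}) (i : nat) : nat :=
  oapp (fun j : 'I_n => mu j : nat) 0%N (insub i).

Lemma mult_of_ord n M (mu : {ffun 'I_n -> 'I_M}) (i : 'I_n) :
  mult_of mu i = mu i.
Proof. by rewrite /mult_of valK. Qed.

Lemma mult_of_ge n M (mu : {ffun 'I_n -> 'I_M}) i :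
  (n <= i)%N -> mult_of mu i = 0%N.
Proof. by move=> ni; rewrite /mult_of insubN // -leqNgt. Qed.

Lemma mult_of_leq n M K (mu : {ffun 'I_n -> 'I_M}) :
  (forall i, mu i <= K)%N -> (forall i, mult_of mu i <= K)%N.
Proof.
move=> muK i; have [lt|le] := ltnP i n; last by rewrite mult_of_ge.
by rewrite (mult_of_ord _ _ _ (Ordinal lt)).
Qed.

Lemma mult_of_inj n M (mu nu : {ffun 'I_n -> 'I_M}) :
  mult_of mu =1 mult_of nu -> mu = nu.
Proof.
move=> E; apply/ffunP=> i; apply/val_inj.
by rewrite /= -!mult_of_ord E.
Qed.

Lemma mult_of_sum n N M (mu : {ffun 'I_n -> 'I_M})
    (P : pred nat) (F : nat -> nat) :
  (n <= N)%N ->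
  (\sum_(i < n | P i) mu i * F i = \sum_(i < N | P i) mult_of mu i * F i)%N.
Proof.
move=> nN; under eq_bigr => i _ do rewrite -mult_of_ord.
rewrite (big_ord_widen_cond N P (fun i => mult_of mu i * F i)%N nN).
rewrite big_mkcondr; apply: eq_bigr => i _.
by case: ltnP => // ni; rewrite mult_of_ge.
Qed.

Lemma eq_mult_of_sum n N M K (mu : {ffun 'I_n -> 'I_M}) (nu : {ffun 'I_N -> 'I_K})
    (P : pred nat) (F : nat -> nat) :
  mult_of mu =1 mult_of nu ->
  (\sum_(i < n | P i) mu i * F i = \sum_(i < N | P i) nu i * F i)%N.
Proof.
move=> E; rewrite (mult_of_sum n (maxn n N)) ?leq_maxl //.
rewrite (mult_of_sum N (maxn n N)) ?leq_maxr //.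
by apply: eq_bigr => i _; rewrite E.
Qed.

(** Re-encodes a multiplicity function over other bounds; it is faithful only
    under the conditions of [mult_of_transfer]. *)
Definition transfer (N K : nat) {n M : nat} (mu : {ffun 'I_n -> 'I_M}) :
  {ffun 'I_N -> 'I_K.+1} := [ffun i : 'I_N => inord (mult_of mu i)].

Lemma mult_of_transfer n M N K (mu : {ffun 'I_n -> 'I_M}) :
  (forall i, mult_of mu i <= K)%N ->
  (forall i, (N <= i)%N -> mult_of mu i = 0%N) ->
  mult_of (transfer N K mu) =1 mult_of mu.
Proof.
move=> muK mu0 i; have [iN|Ni] := ltnP i N; last by rewrite mult_of_ge ?mu0.
by rewrite (mult_of_ord _ _ _ (Ordinal iN)) ffunE inordK // ltnS.
Qed.

Definition weight {n M : nat} (mu : {ffun 'I_n -> 'I_M}) : nat :=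
  (\sum_(i < n) mu i * i.+1)%N.

Definition divisible_parts (k : nat) {n M : nat}
    (mu : {ffun 'I_n -> 'I_M}) : nat :=
  (\sum_(i < n | k %| i.+1) mu i)%N.

Lemma eq_weight n N M K (mu : {ffun 'I_n -> 'I_M}) (nu : {ffun 'I_N -> 'I_K}) :
  mult_of mu =1 mult_of nu -> weight mu = weight nu.
Proof. exact: (eq_mult_of_sum _ _ _ _ _ _ xpredT succn). Qed.

Lemma eq_divisible_parts k n N M K
    (mu : {ffun 'I_n -> 'I_M}) (nu : {ffun 'I_N -> 'I_K}) :
  mult_of mu =1 mult_of nu -> divisible_parts k mu = divisible_parts k nu.
Proof.
move=> /(eq_mult_of_sum _ _ _ _ _ _ (fun i => k %| i.+1) (fun=> 1))%N E.
rewrite /divisible_parts; under eq_bigr do rewrite -[nat_of_ord (mu _)]muln1.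
by rewrite E; apply: eq_bigr => i _; rewrite muln1.
Qed.

Lemma mult_of_weight n M (mu : {ffun 'I_n -> 'I_M}) i :
  (mult_of mu i * i.+1 <= weight mu)%N.
Proof.
have [lt|le] := ltnP i n; last by rewrite mult_of_ge.
rewrite (mult_of_ord _ _ _ (Ordinal lt)) /weight.
by rewrite (bigD1 (Ordinal lt)) //= leq_addr.
Qed.

(** The definition of a_k n uses index types that depend on n.  A generating
    function needs one index type for all n <= N, with the bound k on the
    multiplicities built into the codomain. *)
Lemma a_eq_sum_weight K n N :
  (n <= N)%N ->
  a_ K.+1 n = (\sum_(nu : {ffun 'I_N -> 'I_K.+1} | weight nu == n)
    divisible_parts K.+1 nu)%N.
Proof.
move=> nN; rewrite /a_.
rewrite (reindex_onto (transfer n n) (transfer N K)) /=; last first.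
  move=> mu /andP[_ /forallP muK]; have muK' := mult_of_leq _ _ K _ muK.
  have E : mult_of (transfer N K mu) =1 mult_of mu.
    by apply: mult_of_transfer => // j Nj; rewrite mult_of_ge // (leq_trans nN).
  apply: mult_of_inj => i; rewrite mult_of_transfer ?E // => j.
    by rewrite E mult_of_leq // => l; rewrite -ltnS.
  by move=> nj; rewrite E mult_of_ge.
(* A part i.+1 occurring in a partition of n has i < n and multiplicity at
   most n, so that nothing is cut off. *)
have transE (nu : {ffun 'I_N -> 'I_K.+1}) :
    weight nu = n -> mult_of (transfer n n nu) =1 mult_of nu.
  move=> wn; apply: mult_of_transfer => i;
    have := mult_of_weight _ _ nu i; rewrite wn; nia.
have backE (nu : {ffun 'I_N -> 'I_K.+1}) :
    mult_lt K.+1 (transfer n n nu) ->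
    transfer N K (transfer n n nu) = nu ->
    mult_of nu =1 mult_of (transfer n n nu).
  move=> /forallP nuK trtr i; rewrite -{1}trtr; apply: mult_of_transfer => {}i.
    exact: mult_of_leq.
  by move=> Ni; rewrite mult_of_ge // (leq_trans nN).
apply: eq_big => [nu|nu]; last first.
  by move=> /andP[/andP[_ nuK] /eqP trtr]; apply/esym/eq_divisible_parts/backE.
apply/idP/eqP=> [/andP[/andP[/eqP wn nuK] /eqP trtr]|wn].
  by rewrite -[RHS]wn; apply/eq_weight/backE.
have E := transE nu wn.
have nuK i : (mult_of nu i <= K)%N by apply: mult_of_leq => j; rewrite -ltnS.
rewrite -andbA; apply/and3P; split.
- by rewrite /is_partition -/(weight _) (eq_weight _ _ _ _ _ _ E) wn.
- by apply/forallP=> i; rewrite -mult_of_ord E ltnS.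
apply/eqP/mult_of_inj => i; rewrite mult_of_transfer ?E // => j; rewrite E //.
exact: mult_of_ge.
Qed.

(** * The generating polynomial of a_k *)

(** Here K.+1 is k, so that the index type of the multiplicities is inhabited. *)
Definition part_poly (K N : nat) : {poly int} :=
  \sum_(nu : {ffun 'I_N -> 'I_K.+1})
    (divisible_parts K.+1 nu)%:Z *: 'X^(weight nu).

Lemma coef_part_poly K N n :
  (n <= N)%N -> (part_poly K N)`_n = (a_ K.+1 n)%:Z.
Proof.
move=> nN; rewrite (a_eq_sum_weight K n N nN) coef_sum
  -[RHS]natz natr_sum [RHS]big_mkcond.
apply: eq_bigr => nu _; rewrite coefZ coefXn eq_sym.
by case: eqP; rewrite ?mulr1 ?mulr0 // natz.
Qed.

(** The marked part j is chosen first.  Expanding the product then amounts to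
    choosing a multiplicity m for every part, and the factor of j counts the
    m copies of j. *)
Lemma part_poly_prod K N :
  part_poly K N = \sum_(j < N | (K.+1 %| j.+1)%N)
    \prod_(i < N) \sum_(m < K.+1) (if i == j then m%:R else 1) * 'X^(m * i.+1).
Proof.
under eq_bigr => j _ do rewrite bigA_distr_bigA /=.
rewrite exchange_big /=; apply: eq_bigr => nu _.
rewrite /divisible_parts -[Posz _]natz natr_sum scaler_suml.
apply: eq_bigr => j _.
rewrite big_split /= prodrXr (bigD1 j) //= eqxx big1 ?mulr1;
  last by move=> i /negPf->.
by rewrite -/(weight nu) scaler_nat mulr_natl.
Qed.

(** Distribute the factors 1 - q^i of O over the parts i.  For i even the factor
    of i only has even exponents.  For i odd, i is not the marked part because
    that one is divisible by the even number k, so its geometric sum times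
    1 - q^i is 1 - q^(k i). *)
Lemma is_even_part_poly K N :
  ~~ odd K.+1 -> is_even_poly (part_poly K N * odd_prod 'X N).
Proof.
move=> evK; rewrite part_poly_prod mulr_suml; apply: is_even_poly_sum => j dj.
rewrite /odd_prod [X in _ * X]big_mkcond [X in _ * X]big_mkord -big_split.
apply: is_even_poly_prod => i _.
rewrite /= -[~~ odd i]/(odd i.+1).
have [oi|ei] := boolP (odd i.+1); last first.
  rewrite mulr1; apply: is_even_poly_sum => m _; apply: is_even_polyM.
    by rewrite /is_even_poly; case: ifP => _; rewrite ?rmorph_nat ?rmorph1.
  by apply: is_even_polyXn; rewrite oddM (negPf ei) andbF.
have -> : (i == j) = false.
  apply/eqP=> ij; move: dj; rewrite -ij => /dvdnP[c ic].
  by move: oi; rewrite ic oddM (negPf evK) andbF.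
have -> : (\sum_(m < K.+1) 1 * 'X^(m * i.+1)) * (1 - 'X^(i.+1)) =
    1 - 'X^(i.+1 * K.+1) :> {poly int}.
  under eq_bigr => m _ do rewrite mul1r mulnC exprM.
  rewrite [RHS](_ : _ = 1 ^+ K.+1 - 'X^(i.+1) ^+ K.+1); last first.
    by rewrite expr1n exprM.
  rewrite subrXX mulrC; congr (_ * _).
  by apply: eq_bigr => m _; rewrite expr1n mul1r.
rewrite /is_even_poly rmorphB rmorph1 /= is_even_polyXn //.
by rewrite oddM (negPf evK) andbF.
Qed.

(** * The recurrence *)

(** The values c = 1 and c = 2 give the two sums of the recurrence. *)
Lemma coef_part_poly_theta K N c :
  (0 < c)%N ->
  (part_poly K N * theta 'X^c N)`_N =
    (a_ K.+1 N)%:Z - 2%:R * \sum_(1 <= m < N.+1)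
      (if (c * m ^ 2 <= N)%N
       then (-1) ^+ (m - 1) * (a_ K.+1 (N - c * m ^ 2))%:Z else 0).
Proof.
move=> c0; rewrite /theta mulrDr mulr1 coefD coef_part_poly //; congr (_ + _).
rewrite mulrCA !mulr_natl coefMn -mulNrn -sumrN big_add1 /= big_mkord.
rewrite mulr_sumr coef_sum; congr (_ *+ _).
apply: eq_bigr => t _; rewrite subn1 /= -exprM.
rewrite mulrCA -(rmorph_sign polyC) coefCM coefMXn.
rewrite ltnNge; case: leqP => // le; last by rewrite mulr0 oppr0.
by rewrite coef_part_poly ?leq_subr // exprS mulN1r mulNr.
Qed.

Lemma square_power_recurrence (k n : nat) (k_ge2 : (2 <= k)%N) (k_even : ~~ odd k)
    (n_odd : odd n) :
  (a_ k n)%:Z =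
    \sum_(1 <= m < n.+1)
      ((if (m ^ 2 <= n)%N then (-1) ^+ (m - 1) * (a_ k (n - m ^ 2))%:Z else 0)
       + (if (2 * m ^ 2 <= n)%N
          then (-1) ^+ (m - 1) * (a_ k (n - 2 * m ^ 2))%:Z else 0)).
Proof.
case: k k_ge2 k_even => // K _ evK.
set G := part_poly K n; set O : {poly int} := odd_prod 'X n.
set V : {poly int} := even_prod 'X n; set O' : {poly int} := odd_prodN 'X n.
have even_total : is_even_poly ((G * O) * (V * (O + O'))).
  apply: is_even_polyM; first exact: is_even_part_poly.
  apply: is_even_polyM; first exact: is_even_poly_even_prod.
  exact: is_even_poly_odd_prodD.
have := is_even_poly_coef_odd _ _ even_total n_odd.
have -> : (G * O) * (V * (O + O')) = G * (V * O ^+ 2) + G * (V * O * O') by ring.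
have Gmod p q : eqmodX n p q -> (G * q)`_n = (G * p)`_n.
  by move=> pq; apply/esym/(eqmodX_mul _ n).
rewrite coefD (Gmod _ _ (theta_eqmodX _ n)) (Gmod _ _ (theta_sqr_eqmodX _ n)).
rewrite -[theta 'X n]/(theta 'X^1 n) !coef_part_poly_theta // big_split /=.
under eq_bigr => m _ do rewrite mul1n.
set x := \sum_(1 <= m < n.+1) _; set y := \sum_(1 <= m < n.+1) _.
lia.
Qed.

Lemma leq_truncn_sqrt (R : archiRcfType) (c n m : nat) :
  (0 < c)%N ->
  (m <= Num.truncn (Num.sqrt (n%:R / c%:R : R)))%N = (c * m ^ 2 <= n)%N.
Proof.
move=> c0; rewrite truncn_ge_nat ?sqrtr_ge0 //.
have c0' : 0 < c%:R :> R by rewrite ltr0n.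
have nc0 : 0 <= n%:R / c%:R :> R by rewrite divr_ge0 ?ler0n.
rewrite -[m%:R]ger0_norm ?ler0n // -sqrtr_sqr ler_sqrt //.
by rewrite ler_pdivlMr // -natrX -natrM ler_nat mulnC.
Qed.

Lemma sum_truncn_sqrt (R : archiRcfType) (c n : nat) (F : nat -> int) :
  (0 < c)%N ->
  \sum_(1 <= m < (Num.truncn (Num.sqrt (n%:R / c%:R : R))).+1) F m =
  \sum_(1 <= m < n.+1) (if (c * m ^ 2 <= n)%N then F m else 0).
Proof.
move=> c0; have lt m :
    (m < (Num.truncn (Num.sqrt (n%:R / c%:R : R))).+1)%N = (c * m ^ 2 <= n)%N.
  by rewrite ltnS leq_truncn_sqrt.
rewrite (big_nat_widen _ _ n.+1); last first.
  rewrite ltnS; have := lt (Num.truncn (Num.sqrt (n%:R / c%:R : R))).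
  rewrite ltnSn.
  by move/esym; nia.
by rewrite big_mkcond; apply: eq_bigr => m _; rewrite lt.
Qed.

Theorem theorem6p3 (R : archiRcfType) (k n : nat)
    (k_ge2 : (2 <= k)%N) (k_even : ~~ odd k) (n_ge1 : (1 <= n)%N)
    (n_odd : odd n) :
  (a_ k n)%:Z =
      \sum_(1 <= m < (Num.truncn (Num.sqrt (n%:R : R))).+1)
        (-1) ^+ (m - 1) * (a_ k (n - m ^ 2))%:Z
    + \sum_(1 <= m < (Num.truncn (Num.sqrt (n%:R / 2%:R : R))).+1)
        (-1) ^+ (m - 1) * (a_ k (n - 2 * m ^ 2))%:Z
  /\
  (* the expanded form, where terms with negative argument are omitted *)
  (a_ k n)%:Z =
    \sum_(1 <= m < n.+1)
      ((if (m ^ 2 <= n)%N then (-1) ^+ (m - 1) * (a_ k (n - m ^ 2))%:Z else 0)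
       + (if (2 * m ^ 2 <= n)%N
          then (-1) ^+ (m - 1) * (a_ k (n - 2 * m ^ 2))%:Z else 0)).
Proof.
have expanded := square_power_recurrence k n k_ge2 k_even n_odd.
split=> //; rewrite {1}expanded big_split /=.
have sum_sqr := sum_truncn_sqrt R 1 n; rewrite divr1 in sum_sqr.
rewrite sum_sqr // sum_truncn_sqrt //.
by congr (_ + _); apply: eq_bigr => m _; rewrite mul1n.
Qed.
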